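(* Let $n$ be a positive integer with $n\neq 1,3$. Then the Euclidean group $\mathrm{E}_n=\mathrm{O}_n\ltimes\mathbb{R}^n$ does not have compact quotients with a pseudo-Riemannian metric such that $\mathrm{E}_n$ acts isometrically and almost effectively. That is, there is no closed subgroup $H\subseteq\mathrm{E}_n$ such that $\mathrm{E}_n/H$ is compact, the action of $\mathrm{E}_n$ on $\mathrm{E}_n/H$ is almost effective, and $\mathrm{E}_n/H$ admits an $\mathrm{E}_n$-invariant pseudo-Riemannian metric.
   Context: $\mathrm{O}_n$ acts on $\mathbb{R}^n$ in the natural way. A Lie group action is almost effective if its kernel is discrete. Pseudo-Riemannian metrics of any signature (including definite) are considered. *)

(* Defs.v *)
From HB Require Import structures.
From mathcomp Require Import all_boot all_order all_algebra generic_quotient.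
From mathcomp Require Import all_classical all_reals.
From mathcomp Require Import topology normedtype derive.

Set Implicit Arguments.
Unset Strict Implicit.
Unset Printing Implicit Defensive.

Import GRing.Theory.
Import numFieldNormedType.Exports.

Local Open Scope classical_set_scope.
Local Open Scope ring_scope.

Section EuclideanGroup.
Variables (R : realType) (n : nat).

(* The pair (A, v) is the isometry x |-> A x + v of R^n. *)
Record euclid := Euclid {
  euclid_val : 'M[R]_n * 'cV[R]_n ;
  euclid_orthogonal : euclid_val.1^T *m euclid_val.1 == 1%:M }.

HB.instance Definition _ := [isSub for euclid_val].
HB.instance Definition _ := [Choice of euclid by <:].

Lemma euclid_one_subproof :
  (1%:M : 'M[R]_n, 0 : 'cV[R]_n).1^T *m (1%:M : 'M[R]_n, 0 : 'cV[R]_n).1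
    == 1%:M.
Proof. by rewrite /= trmx1 mulmx1. Qed.

Definition euclid_one : euclid := Euclid euclid_one_subproof.

Lemma euclid_mul_subproof (g h : euclid) :
  let: p := ((val g).1 *m (val h).1, (val g).2 + (val g).1 *m (val h).2) in
  p.1^T *m p.1 == 1%:M.
Proof.
case: g h => [[A v] /= /eqP AA] [[B w] /= /eqP BB].
by rewrite trmx_mul mulmxA -(mulmxA B^T) AA mulmx1 BB.
Qed.

Definition euclid_mul (g h : euclid) : euclid := Euclid (euclid_mul_subproof g h).

Lemma euclid_inv_subproof (g : euclid) :
  let: p := ((val g).1^T, - ((val g).1^T *m (val g).2)) in
  p.1^T *m p.1 == 1%:M.
Proof. by case: g => [[A v] /= /eqP /mulmx1C AA]; rewrite trmxK AA. Qed.

Definition euclid_inv (g : euclid) : euclid := Euclid (euclid_inv_subproof g).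

Lemma euclid_mulA : associative euclid_mul.
Proof.
move=> [[A v] pA] [[B w] pB] [[C u] pC]; apply: val_inj => /=.
by rewrite mulmxA mulmxDr !mulmxA addrA.
Qed.

Lemma euclid_mul1 : left_id euclid_one euclid_mul.
Proof.
by move=> [[A v] pA]; apply: val_inj; rewrite /= !mul1mx add0r.
Qed.

Lemma euclid_mulr1 : right_id euclid_one euclid_mul.
Proof.
by move=> [[A v] pA]; apply: val_inj; rewrite /= mulmx1 mulmx0 addr0.
Qed.

Lemma euclid_mulV : left_inverse euclid_one euclid_inv euclid_mul.
Proof.
move=> [[A v] pA]; apply: val_inj => /=.
by rewrite (eqP pA) addNr.
Qed.

Lemma euclid_mulrV : right_inverse euclid_one euclid_inv euclid_mul.
Proof.
move=> [[A v] pA]; apply: val_inj => /=.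
by rewrite (mulmx1C (eqP pA)) mulmxN mulmxA (mulmx1C (eqP pA)) mul1mx subrr.
Qed.

HB.instance Definition _ := isGroup.Build euclid
  euclid_mulA euclid_mul1 euclid_mulr1 euclid_mulV euclid_mulrV.

HB.instance Definition _ :=
  Topological.copy euclid (initial_topology euclid_val).

End EuclideanGroup.

Section CosetSpace.
Variables (G : groupType) (H : groupClosed G).
Local Open Scope group_scope.
Local Open Scope quotient_scope.

Definition coset_rel : rel G := fun x y => x^-1 * y \in H.

Lemma coset_rel_equiv : equiv_class_of coset_rel.
Proof.
split=> [x|x y|y x z]; rewrite /coset_rel.
- by rewrite mulVg gpred1.
- by rewrite -gpredV invgM invgK.
- by move=> xy yz; rewrite -(mulgK y x^-1) -mulgA gpredM.
Qed.

Canonical coset_equiv := EquivRelPack coset_rel_equiv.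

(* The points are the left cosets xH. *)
Definition coset_space : Type := {eq_quot coset_equiv}.

HB.instance Definition _ := EqQuotient.on coset_space.

Definition coset_act (g : G) (p : coset_space) : coset_space :=
  \pi_coset_space (g * repr p).

Lemma coset_act_pi (g x : G) :
  coset_act g (\pi_coset_space x) = \pi_coset_space (g * x).
Proof.
apply/(@eqmodP _ coset_equiv); rewrite /= /coset_rel.
rewrite invgM mulgA -(mulgA _ g^-1) mulVg mulg1.
by apply/(@eqmodP _ coset_equiv); rewrite reprK.
Qed.

End CosetSpace.

Section Smooth.
Variable R : realType.

(* C^k on an open set U of a finite-dimensional space: for k > 0,
   differentiable with all directional derivatives of class C^(k-1). *)
Fixpoint classC {V W : normedModType R} (k : nat) (U : set V) (f : V -> W)
    : Prop :=
  if k is k'.+1 then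
    (forall x, U x -> differentiable f x) /\
    (forall v, classC k' U (fun x => 'D_v f x))
  else forall x, U x -> {for x, continuous f}.

Definition smooth {V W : normedModType R} (U : set V) (f : V -> W) : Prop :=
  forall k, classC k U f.

End Smooth.

Section Manifold.
Variables (R : realType) (M : topologicalType) (m : nat).

(* The values of chart_map outside chart_dom, and of chart_inv outside the
   image of chart_dom, are irrelevant. *)
Record chart := Chart {
  chart_dom : set M ;
  chart_map : M -> 'rV[R]_m ;
  chart_inv : 'rV[R]_m -> M }.

Definition is_chart (c : chart) : Prop :=
  let U := chart_dom c in let V := chart_map c @` U in
  [/\ open U, open V,
      forall p, U p -> chart_inv c (chart_map c p) = p,
      forall p, U p -> {for p, continuous (chart_map c)} &
      forall x, V x -> {for x, continuous (chart_inv c)}].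

Definition is_atlas (A : set chart) : Prop :=
  [/\ forall c, A c -> is_chart c,
      forall p, exists2 c, A c & chart_dom c p &
      forall c d, A c -> A d ->
        smooth (chart_map c @` (chart_dom c `&` chart_dom d))
               (chart_map d \o chart_inv c)].

Definition in_charts (f : M -> M) (c d : chart) : 'rV[R]_m -> 'rV[R]_m :=
  chart_map d \o f \o chart_inv c.

(* A (0,2)-tensor field, given by its matrices of components in each chart:
   the tensor takes the value  u *m B c x *m v^T  on the tangent vectors with
   coordinates u and v. *)
Definition tensor2 := chart -> 'rV[R]_m -> 'M[R]_m.

(* f^* B = B in coordinates; the row-vector Jacobian 'J F x sends u to
   'd F x u = u *m 'J F x. *)
Definition preserves (A : set chart) (B : tensor2) (f : M -> M) : Prop :=
  forall c d p, A c -> A d -> chart_dom c p -> chart_dom d (f p) ->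
    let x := chart_map c p in let F := in_charts f c d in
    differentiable F x /\
    B c x = 'J F x *m B d (F x) *m ('J F x)^T.

(* Smooth symmetric (0,2)-tensor field with constant signature: at every point
   there is a basis (the rows of P) which is orthonormal with q vectors of
   square -1 and m - q of square 1.  Preservation under the identity is the
   transformation law between charts. *)
Definition pseudo_riemannian (A : set chart) (B : tensor2) : Prop :=
  [/\ forall c, A c -> smooth (chart_map c @` chart_dom c) (B c),
      preserves A B id,
      forall c p, A c -> chart_dom c p ->
        (B c (chart_map c p))^T = B c (chart_map c p) &
      exists2 q : nat, (q <= m)%N &
        forall c p, A c -> chart_dom c p ->
          exists2 P : 'M[R]_m, P \in unitmx &
            P *m B c (chart_map c p) *m P^T
              = diag_mx (\row_(i < m) (-1) ^+ (i < q)%N)].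

End Manifold.

Section HomogeneousSpace.
Variables (R : realType) (n : nat) (H : groupClosed (euclid R n)).
Local Open Scope quotient_scope.

Definition homogeneous_space : topologicalType :=
  quotient_topology (coset_space H).

Definition homogeneous_pi (g : euclid R n) : homogeneous_space :=
  \pi_(coset_space H) g.

Definition homogeneous_act (g : euclid R n)
  (p : homogeneous_space) : homogeneous_space := coset_act g p.

Definition action_kernel : set (euclid R n) :=
  [set g | forall p, homogeneous_act g p = p].

Definition almost_effective : Prop := isolated action_kernel = action_kernel.

(* Smoothness of a map defined on an open subset U of E_n, where E_n is seen as
   an embedded submanifold of the space of pairs (matrix, vector): the map
   locally extends to a smooth map of the ambient space. *)
Definition smooth_from_euclid {W : normedModType R} (U : set (euclid R n))
    (f : euclid R n -> W) : Prop :=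
  forall g, U g -> exists2 N : set ('M[R]_n * 'cV[R]_n),
    open_nbhs (val g) N &
    exists2 F : 'M[R]_n * 'cV[R]_n -> W, smooth N F &
      forall h, U h -> N (val h) -> F (val h) = f h.

(* An atlas of the smooth structure of the homogeneous space E_n / H: this is
   the unique smooth structure such that the projection is smooth and
   admits smooth local sections near every point.  As H is closed,
   the quotient topology is Hausdorff and second countable. *)
Definition homogeneous_atlas (m : nat)
    (A : set (chart R homogeneous_space m)) : Prop :=
  [/\ is_atlas A,
      forall c, A c ->
        smooth_from_euclid (homogeneous_pi @^-1` chart_dom c)
                           (chart_map c \o homogeneous_pi) &
      forall p : homogeneous_space, exists2 U, open_nbhs p U &
        exists2 s : homogeneous_space -> euclid R n,
          forall q, U q -> homogeneous_pi (s q) = q &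
          forall c, A c ->
            smooth (chart_map c @` (chart_dom c `&` U))
                   (fun x => val (s (chart_inv c x)))].

Definition invariant_metric : Prop :=
  exists (m : nat) (A : set (chart R homogeneous_space m))
         (B : tensor2 R homogeneous_space m),
    [/\ homogeneous_atlas A, pseudo_riemannian A B &
        forall g, preserves A B (homogeneous_act g)].

End HomogeneousSpace.

(* Main.v *)
Require Import Defs.
From HB Require Import structures.
From mathcomp Require Import all_boot all_order all_algebra ring lra.
From mathcomp Require Import all_classical all_reals.
From mathcomp Require Import topology normedtype derive trigo.

(* Let D be the differential at 1 of the orbit map g |-> gH read in a chart at
   the base point.  The metric pulls back along D to a symmetric bilinear form
   on the Lie algebra so_n + R^n which is Ad(H)-invariant.  Since E_n / H is
   compact, the translation parts of the elements of H are coarsely dense in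
   R^n, while their linear parts are bounded; so the invariance relations, which
   are polynomial in the translation part v, hold coefficient by coefficient:
   <X v, X v> = 0 and <X v, Y> + <X, Y v> = 0 for all skew X, Y and all v.
   Evaluating them on the generators E_ij - E_ji of so_n shows, for 1 < n <> 3,
   that R^n lies in the radical of the form (for n = 3 the form
   <v, X> = v . x, where X u is the vector product of x and u, survives).  The
   radical is the kernel of D, because D maps the Lie algebra onto the tangent
   space.  Thus the translations fix the base point, H contains all of them, and
   as they form a normal subgroup they act trivially on E_n / H. *)

Set Implicit Arguments.
Unset Strict Implicit.
Unset Printing Implicit Defensive.

Import Order.TTheory GRing.Theory Num.Theory.
Import numFieldNormedType.Exports.

Local Open Scope classical_set_scope.
Local Open Scope ring_scope.

(** * Skew-symmetric matrices *)

Section SkewMatrices.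
Variables (R : numFieldType) (n : nat).
Implicit Types (i j k : 'I_n) (X : 'M[R]_n).

Definition rotgen i j : 'M[R]_n := delta_mx i j - delta_mx j i.

Definition skew_sym X := X^T == - X.

Lemma skew_rotgen i j : skew_sym (rotgen i j).
Proof. by rewrite /skew_sym /rotgen linearB /= !trmx_delta opprB. Qed.

Lemma rotgen_delta i j k :
  rotgen i j *m delta_mx k (0 : 'I_1)
    = (j == k)%:R *: delta_mx i 0 - (i == k)%:R *: delta_mx j 0.
Proof. by rewrite mulmxBl !mul_delta_mx_cond !scaler_nat. Qed.

(** For distinct i and j the square of [rotgen i j] is minus the projection onto the plane of e_i
    and e_j. The identity is the condition under which Rodrigues' formula gives orthogonal
    matrices. *)
Lemma rotgen_cube i j :
  rotgen i j *m rotgen i j *m rotgen i j = - rotgen i j.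
Proof.
have [->|neq_ij] := eqVneq i j; first by rewrite /rotgen subrr !mulmx0 oppr0.
have neq_ji : j != i by rewrite eq_sym.
have deltaM k l k' l' : delta_mx k l *m delta_mx k' l'
    = (l == k')%:R *: delta_mx k l' :> 'M[R]_n.
  by rewrite mul_delta_mx_cond scaler_nat.
have -> : rotgen i j *m rotgen i j = - delta_mx i i - delta_mx j j.
  rewrite /rotgen !(mulmxBl, mulmxBr, deltaM) !eqxx (negPf neq_ij).
  by rewrite (negPf neq_ji) !scale0r !scale1r
    !(oppr0, sub0r, subr0, add0r, addr0) ?opprD.
rewrite /rotgen !(mulmxBl, mulmxBr, mulNmx, deltaM) !eqxx (negPf neq_ij).
rewrite (negPf neq_ji) !scale0r !scale1r
  !(oppr0, sub0r, subr0, opprK, opprB, add0r, addr0).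
exact: addrC.
Qed.

(** A skew X is half of X - X^T, hence the combination of the [rotgen i j] with coefficients X i j /
    2. Linear statements on so_n thus reduce to these generators. *)
Lemma skew_ind (P : 'M[R]_n -> Prop) :
  P 0 -> (forall X Y, P X -> P Y -> P (X + Y)) ->
  (forall a X, P X -> P (a *: X)) ->
  (forall i j, P (rotgen i j)) -> forall X, skew_sym X -> P X.
Proof.
move=> P0 PD PZ Pgen X /eqP skX.
have -> : X = \sum_i \sum_j (2^-1 * X i j) *: rotgen i j.
  rewrite {1}(_ : X = 2^-1 *: (X - X^T)); last first.
    by rewrite skX opprK scalerDr -scalerDl -mulr2n -[_ *+ _]mulr_natr mulVf
      ?pnatr_eq0 // scale1r.
  rewrite {1 2}(matrix_sum_delta X) linear_sum /= -sumrB scaler_sumr.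
  apply: eq_bigr => i _; rewrite linear_sum /= -sumrB scaler_sumr.
  apply: eq_bigr => j _.
  by rewrite linearZ /= trmx_delta -scalerBr scalerA.
by elim/big_ind: _ => // i _; elim/big_ind: _ => // j _; apply/PZ/Pgen.
Qed.

End SkewMatrices.

(** * Nil-invariant forms on the Euclidean Lie algebra *)

Section PullbackForm.
Variables (R : comPzRingType) (U : lmodType R) (m : nat).
Variables (D : {linear U -> 'rV[R]_m}) (B : 'M[R]_m).
Implicit Types Z : U.

Definition pullback_form Z Z' : R := (D Z *m B *m (D Z')^T) 0 0.

Lemma pullback_formDl Z1 Z2 Z' :
  pullback_form (Z1 + Z2) Z' = pullback_form Z1 Z' + pullback_form Z2 Z'.
Proof. by rewrite /pullback_form linearD !mulmxDl mxE. Qed.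

Lemma pullback_formDr Z Z1 Z2 :
  pullback_form Z (Z1 + Z2) = pullback_form Z Z1 + pullback_form Z Z2.
Proof. by rewrite /pullback_form linearD linearD mulmxDr mxE. Qed.

Lemma pullback_formZl a Z Z' :
  pullback_form (a *: Z) Z' = a * pullback_form Z Z'.
Proof. by rewrite /pullback_form linearZ -!scalemxAl mxE. Qed.

Lemma pullback_formZr a Z Z' :
  pullback_form Z (a *: Z') = a * pullback_form Z Z'.
Proof. by rewrite /pullback_form linearZ linearZ /= -scalemxAr mxE. Qed.

Lemma pullback_form0l Z : pullback_form 0 Z = 0.
Proof. by rewrite -(scale0r 0) pullback_formZl mul0r. Qed.

Lemma pullback_form0r Z : pullback_form Z 0 = 0.
Proof. by rewrite -(scale0r 0) pullback_formZr mul0r. Qed.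

Lemma pullback_formNl Z Z' : pullback_form (- Z) Z' = - pullback_form Z Z'.
Proof. by rewrite -scaleN1r pullback_formZl mulN1r. Qed.

Lemma pullback_formNr Z Z' : pullback_form Z (- Z') = - pullback_form Z Z'.
Proof. by rewrite -scaleN1r pullback_formZr mulN1r. Qed.

Lemma pullback_formC Z Z' :
  B^T = B -> pullback_form Z Z' = pullback_form Z' Z.
Proof.
move=> symB; rewrite /pullback_form -[in RHS]symB.
have -> : D Z' *m B^T *m (D Z)^T = (D Z *m B *m (D Z')^T)^T.
  by rewrite !trmx_mul trmxK mulmxA.
by rewrite [RHS]mxE.
Qed.

End PullbackForm.

Lemma col_ind (R : pzRingType) n (P : 'cV[R]_n -> Prop) :
  P 0 -> (forall v w, P v -> P w -> P (v + w)) ->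
  (forall a v, P v -> P (a *: v)) ->
  (forall i, P (delta_mx i 0)) -> forall v, P v.
Proof.
move=> P0 PD PZ Pd v; rewrite (matrix_sum_delta v).
elim/big_ind: _ => // i _; elim/big_ind: _ => // j _.
by rewrite (ord1 j); apply/PZ/Pd.
Qed.

Section NilInvariance.
Variables (R : realFieldType) (n m : nat).
Variables (D : {linear ('M[R]_n * 'cV[R]_n)%type -> 'rV[R]_m}) (B : 'M[R]_m).
Local Notation form := (pullback_form D B).
Hypothesis form_sym : forall Z Z', form Z Z' = form Z' Z.
Implicit Types (v w x : 'cV[R]_n) (X Y : 'M[R]_n).

Let transD v w : (0 : 'M[R]_n, v + w) = (0, v) + (0, w).
Proof. by rewrite -[RHS]/(0 + 0, v + w) addr0. Qed.

Let transZ a v : (0 : 'M[R]_n, a *: v) = a *: (0, v).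
Proof. by rewrite -[RHS]/(a *: 0, a *: v) scaler0. Qed.

Let skewD X Y : (X + Y, 0 : 'cV[R]_n) = (X, 0) + (Y, 0).
Proof. by rewrite -[RHS]/(X + Y, 0 + 0) addr0. Qed.

Let skewZ a X : (a *: X, 0 : 'cV[R]_n) = a *: (X, 0).
Proof. by rewrite -[RHS]/(a *: X, a *: 0) scaler0. Qed.

(** The generator for i and j sends e_j to e_i, so every e_i is isotropic; the one for i and k sends
    e_k - e_i to e_i + e_k, and expanding the square gives the mixed products. An index j other than
    i exists as n > 1. *)
Lemma form_translations : (1 < n)%N ->
  (forall X x, skew_sym X -> form (0, X *m x) (0, X *m x) = 0) ->
  forall v w, form (0, v) (0, w) = 0.
Proof.
move=> n_gt1 isoX.
have diag0 i : form (0, delta_mx i 0) (0, delta_mx i 0) = 0.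
  have [j neq_ji] : exists j : 'I_n, j != i.
    have [i0|i_neq0] := eqVneq (val i) 0%N.
      by exists (Ordinal n_gt1); rewrite -val_eqE /= i0.
    by exists (Ordinal (ltnW n_gt1)); rewrite -val_eqE /= eq_sym.
  have := isoX _ (delta_mx j 0) (skew_rotgen R i j).
  by rewrite rotgen_delta eqxx eq_sym (negPf neq_ji) scale1r scale0r subr0.
have delta0 i k : form (0, delta_mx i 0) (0, delta_mx k 0) = 0.
  have [->//|neq_ik] := eqVneq i k.
  have := isoX _ (delta_mx k 0 - delta_mx i 0) (skew_rotgen R i k).
  rewrite mulmxBr !rotgen_delta !eqxx (negPf neq_ik) eq_sym (negPf neq_ik).
  rewrite !scale1r !scale0r subr0 sub0r opprK transD.
  rewrite !(pullback_formDl, pullback_formDr) !diag0 addr0 add0r.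
  rewrite [X in _ + X]form_sym -mulr2n => /eqP.
  by rewrite mulrn_eq0 => /eqP.
move=> v w; elim/col_ind: v => [|v v' IHv IHv'|a v IHv|i].
- exact: pullback_form0l.
- by rewrite transD pullback_formDl IHv IHv' addr0.
- by rewrite transZ pullback_formZl IHv mulr0.
elim/col_ind: w => [|v v' IHv IHv'|a v IHv|k //].
- exact: pullback_form0r.
- by rewrite transD pullback_formDr IHv IHv' addr0.
- by rewrite transZ pullback_formZr IHv mulr0.
Qed.

(** Taking X = Y = E_ij - E_ji and v = e_j yields twice the pairing of e_i with that generator. For
    k outside i and j, take v = e_l with a fourth index l: E_kl - E_lk sends e_l to e_k, while E_ij
    - E_ji kills e_l. *)
Lemma form_translation_rotation : (1 < n)%N -> n <> 3%N ->
  (forall X Y v, skew_sym X -> skew_sym Y ->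
     form (0, X *m v) (Y, 0) + form (X, 0) (0, Y *m v) = 0) ->
  forall v X, skew_sym X -> form (0, v) (X, 0) = 0.
Proof.
move=> n_gt1 n_neq3 antiX.
have gen1 i j : form (0, delta_mx i 0) (rotgen R i j, 0) = 0.
  have [->|neq_ij] := eqVneq i j.
    by rewrite /rotgen subrr pullback_form0r.
  have := antiX _ _ (delta_mx j 0) (skew_rotgen R i j) (skew_rotgen R i j).
  rewrite rotgen_delta eqxx (negPf neq_ij) scale1r scale0r subr0.
  by rewrite [X in _ + X]form_sym -mulr2n => /eqP; rewrite mulrn_eq0 => /eqP.
have gen k i j : form (0, delta_mx k 0) (rotgen R i j, 0) = 0.
  have [->//|neq_ki] := eqVneq k i.
  have [->|neq_kj] := eqVneq k j.
    rewrite /rotgen -opprB -/(rotgen R j i) -scaleN1r skewZ.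
    by rewrite pullback_formZr gen1 mulr0.
  have [ij|neq_ij] := eqVneq i j.
    by rewrite ij /rotgen subrr pullback_form0r.
  (* The three distinct indices k, i, j force n >= 3, so n > 3 as n is not 3, and a fourth index is
     left. *)
  have [l [lk li lj]] : exists l : 'I_n, [/\ l != k, l != i & l != j].
    have n_gt3 : (3 < n)%N.
      have : (3 <= n)%N.
        have /card_uniqP uniq_kij : uniq [:: k; i; j].
          by rewrite /= !inE negb_or neq_ki neq_kj neq_ij.
        have := max_card [in [:: k; i; j]]; rewrite card_ord.
        by rewrite uniq_kij.
      by rewrite leq_eqVlt => /orP[/eqP/esym|].
    have /existsP[l] : [exists l, l \notin [:: k; i; j]].
      rewrite -negb_forall; apply/negP => /forallP all_kij.
      have := card_size [:: k; i; j].
      have -> : #|[:: k; i; j]| = n.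
        by rewrite -[RHS]card_ord; apply: eq_card => l; rewrite all_kij.
      by rewrite leqNgt n_gt3.
    by rewrite !inE !negb_or => /and3P[]; exists l.
  have := antiX _ _ (delta_mx l 0) (skew_rotgen R k l) (skew_rotgen R i j).
  rewrite !rotgen_delta eqxx eq_sym (negPf lk) eq_sym (negPf lj).
  rewrite eq_sym (negPf li) scale1r !scale0r !subr0.
  by rewrite pullback_form0r addr0.
move=> v X; elim/skew_ind => [|Y Y' IH IH'|a Y IH|i j].
- exact: pullback_form0r.
- by rewrite skewD pullback_formDr IH IH' addr0.
- by rewrite skewZ pullback_formZr IH mulr0.
elim/col_ind: v => [|v v' IHv IHv'|a v IHv|k //].
- exact: pullback_form0l.
- by rewrite transD pullback_formDl IHv IHv' addr0.
- by rewrite transZ pullback_formZl IHv mulr0.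
Qed.

End NilInvariance.

(** * Bounds *)

Section MatrixBounds.
Variable R : realType.

Lemma mx_entry_le_norm p q (M : 'M[R]_(p, q)) i j : `|M i j| <= `|M|.
Proof.
rewrite [leRHS]/Num.Def.normr /= mx_normrE.
exact: (le_bigmax _ (fun ij : 'I_p * 'I_q => `|M ij.1 ij.2|) (i, j)).
Qed.

Lemma mx_norm_le p q (M : 'M[R]_(p, q)) r :
  0 <= r -> (forall i j, `|M i j| <= r) -> `|M| <= r.
Proof.
move=> r_ge0 leMr; rewrite [leLHS]/Num.Def.normr /= mx_normrE.
by apply: bigmax_le => // -[i j] _; exact: leMr.
Qed.

(** The matrix norm is the largest absolute entry and is not submultiplicative; this sum is the
    constant that replaces it in bounds for products. *)
Definition entry_sum p q (M : 'M[R]_(p, q)) : R := \sum_i \sum_j `|M i j|.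

Lemma entry_sum_ge0 p q (M : 'M[R]_(p, q)) : 0 <= entry_sum M.
Proof. by do 2 apply: sumr_ge0 => ? _. Qed.

Lemma mulmx3_entry_le p q r s (P : 'M[R]_(p, q)) (X : 'M_(q, r))
    (Q : 'M_(r, s)) a b i j :
  (forall k, `|P i k| <= a) -> (forall l, `|Q l j| <= b) ->
  `|(P *m X *m Q) i j| <= entry_sum X * (a * b).
Proof.
move=> leP leQ; rewrite -mulmxA mxE mulr_suml.
apply: le_trans (ler_norm_sum _ _ _) _; apply: ler_sum => k _.
rewrite normrM mxE [in leRHS]mulr_suml.
apply: le_trans (ler_wpM2l _ (ler_norm_sum _ _ _)) _ => //.
rewrite mulr_sumr; apply: ler_sum => l _.
rewrite normrM mulrCA; apply: ler_wpM2l => //.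
exact: ler_pM.
Qed.

Lemma mulmx_norm_le p q r (X : 'M[R]_(p, q)) (Y : 'M_(q, r)) :
  `|X *m Y| <= entry_sum X * `|Y|.
Proof.
apply: mx_norm_le => [|i j]; first by rewrite mulr_ge0 ?entry_sum_ge0.
rewrite -[X in X *m _]mul1mx -[`|Y|]mul1r.
apply: mulmx3_entry_le => [k|l]; last exact: mx_entry_le_norm.
by rewrite mxE; case: (_ == _); rewrite ?normr1 ?normr0.
Qed.

(** The columns of A are unit vectors. *)
Lemma orthogonal_entry_le1 n (A : 'M[R]_n) i j :
  A^T *m A = 1%:M -> `|A i j| <= 1.
Proof.
move=> /matrixP/(_ j j); rewrite !mxE eqxx mulr1n => orthA.
rewrite -(@expr_le1 _ 2) // real_normK ?num_real //.
rewrite -orthA (bigD1 i) //= mxE -expr2 lerDl.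
by apply: sumr_ge0 => k _; rewrite mxE -expr2 sqr_ge0.
Qed.

(** The bound is uniform in A: this is how the compactness of O_n enters. *)
Lemma orthogonal_conj_norm_le n (A X : 'M[R]_n) :
  A^T *m A = 1%:M -> `|A^T *m X *m A| <= entry_sum X.
Proof.
move=> orthA; apply: mx_norm_le => [|i j]; first exact: entry_sum_ge0.
rewrite (_ : entry_sum X = entry_sum X * (1 * 1)); last by rewrite !mulr1.
by apply: mulmx3_entry_le => k; rewrite ?mxE orthogonal_entry_le1.
Qed.

End MatrixBounds.

(** * Polynomial identities with bounded coefficients *)

Definition bounded_seq (R : realType) (V : normedZmodType R) (f : nat -> V) :=
  exists K, forall t, `|f t| <= K.

Section BoundedSequences.
Variables (R : realType) (V : normedZmodType R).
Implicit Types f g : nat -> V.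

Lemma bounded_seq_cst (v : V) : bounded_seq (fun=> v).
Proof. by exists `|v|. Qed.

Lemma bounded_seqD f g :
  bounded_seq f -> bounded_seq g -> bounded_seq (fun t => f t + g t).
Proof.
move=> [K leK] [L leL]; exists (K + L) => t.
exact: le_trans (ler_normD _ _) (lerD (leK t) (leL t)).
Qed.

Lemma bounded_seqN f : bounded_seq f -> bounded_seq (fun t => - f t).
Proof. by move=> [K leK]; exists K => t; rewrite normrN. Qed.

Lemma bounded_seqB f g :
  bounded_seq f -> bounded_seq g -> bounded_seq (fun t => f t - g t).
Proof. by move=> bf bg; apply: bounded_seqD => //; exact: bounded_seqN. Qed.

(** The lower coefficients may vary with t. If K and L bound them, then |c| t^2 <= (K + L) t for t
    >= 1, which fails for large t unless c = 0. *)
Lemma quadratic_bounded_coef (c : R) (b d : nat -> R) :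
  bounded_seq b -> bounded_seq d ->
  (forall t, c * t%:R ^+ 2 + b t * t%:R + d t = 0) -> c = 0.
Proof.
move=> [K leb] [L led] eq0; apply/eqP; rewrite -normr_eq0 eq_le normr_ge0 andbT.
rewrite leNgt; apply/negP => c_gt0.
have L_ge0 : 0 <= L := le_trans (normr_ge0 _) (led 0%N).
(* The successor puts t strictly above (K + L) / |c| and also ensures t >= 1, so that L <= L t. *)
pose t := (Num.truncn ((K + L) / `|c|)).+1.
have lt_t : (K + L) / `|c| < t%:R by rewrite /t truncnS_gt.
have t_ge1 : 1 <= t%:R :> R by rewrite ler1n.
have : `|c| * t%:R ^+ 2 <= (K + L) * t%:R.
  have -> : `|c| * t%:R ^+ 2 = `|b t * t%:R + d t|.
    rewrite -[t%:R ^+ 2]ger0_norm ?sqr_ge0 // -normrM -normrN.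
    by congr `|_|; apply/eqP; rewrite eq_sym -subr_eq0 opprK addrC addrA eq0.
  apply: le_trans (ler_normD _ _) _; rewrite normrM [`|t%:R|]ger0_norm //.
  have := leb t; have := led t; nra.
rewrite expr2 mulrA ler_pM2r ?(lt_le_trans ltr01) // leNgt.
by move/negP; apply; rewrite [ltRHS]mulrC -ltr_pdivrMr.
Qed.

End BoundedSequences.

(** * Forms invariant under a coarsely dense set of isometries *)

Section CocompactInvariance.
Variables (R : realType) (n m : nat).
Variables (D : {linear ('M[R]_n * 'cV[R]_n)%type -> 'rV[R]_m}) (B : 'M[R]_m).
Local Notation form := (pullback_form D B).
Hypothesis D_continuous : continuous D.
Hypothesis form_sym : forall Z Z', form Z Z' = form Z' Z.

(* S A v stands for: the isometry (A, v) belongs to H. *)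
Variable S : 'M[R]_n -> 'cV[R]_n -> Prop.
Hypothesis S_orthogonal : forall A v, S A v -> A^T *m A = 1%:M.
Hypothesis S_coarse : exists k, forall x, exists2 Aa,
  `|Aa.2| <= k & S Aa.1 (x + Aa.2).
(** The adjoint action of (A, v) sends (A^T X A, 0) to (X, - X v). In this form of Ad-invariance the
    left side is polynomial in v and the right side stays bounded. *)
Hypothesis S_invariant : forall A v (X Y : 'M[R]_n),
  S A v -> skew_sym X -> skew_sym Y ->
  form (X, - (X *m v)) (Y, - (Y *m v))
    = form (A^T *m X *m A, 0) (A^T *m Y *m A, 0).

Lemma bounded_seq_form (f g : nat -> 'M[R]_n * 'cV[R]_n) :
  bounded_seq f -> bounded_seq g -> bounded_seq (fun t => form (f t) (g t)).
Proof.
have [k k_gt0 leD] := linear_lipschitz D_continuous.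
move=> [K leK] [L leL]; exists (entry_sum B * (k * K * (k * L))) => t.
have leDs (Z : 'M[R]_n * 'cV[R]_n) r : `|Z| <= r -> forall i j,
    `|D Z i j| <= k * r.
  move=> ler i j; apply: le_trans (mx_entry_le_norm _ _ _) _.
  by apply: le_trans (leD _) _; rewrite ler_pM2l.
by apply: mulmx3_entry_le => l; rewrite ?mxE; exact: leDs.
Qed.

Lemma bounded_seq_trans (f : nat -> 'cV[R]_n) : bounded_seq f ->
  bounded_seq (fun t => (0 : 'M[R]_n, f t)).
Proof.
move=> [K leK]; exists K => t.
by rewrite prod_normE /= normr0 max_r.
Qed.

Lemma bounded_seq_mulmx (X : 'M[R]_n) (f : nat -> 'cV[R]_n) : bounded_seq f ->
  bounded_seq (fun t => X *m f t).
Proof.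
move=> [K leK]; exists (entry_sum X * K) => t.
apply: le_trans (mulmx_norm_le _ _) _.
by rewrite ler_wpM2l ?entry_sum_ge0.
Qed.

Lemma bounded_seq_rot (f : nat -> 'M[R]_n) : bounded_seq f ->
  bounded_seq (fun t => (f t, 0 : 'cV[R]_n)).
Proof.
move=> [K leK]; exists K => t.
by rewrite prod_normE /= normr0 max_l.
Qed.

(* Evaluating the invariance at the elements (A t, t x + a t) of S, for t in
   nat, gives a quadratic polynomial identity in t with bounded coefficients,
   since A t is orthogonal and a t is bounded. *)
Lemma coarse_identity (X Y : 'M[R]_n) x : skew_sym X -> skew_sym Y ->
  exists a d : nat -> _, [/\ bounded_seq a, bounded_seq d &
    forall t : nat, form (0, X *m x) (0, Y *m x) * t%:R ^+ 2
      + (form (0, X *m x) (0, Y *m a t) + form (0, X *m a t) (0, Y *m x)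
         - form (0, X *m x) (Y, 0) - form (X, 0) (0, Y *m x)) * t%:R
      + d t = 0].
Proof.
move=> skX skY; have [k kS] := S_coarse.
have [Aa Aa_le AaS] : exists2 Aa : nat -> 'M[R]_n * 'cV[R]_n,
    forall t, `|(Aa t).2| <= k & forall t, S (Aa t).1 (t%:R *: x + (Aa t).2).
  pose Aa t := sval (cid2 (kS (t%:R *: x))).
  by exists Aa => t; rewrite /Aa; case: cid2.
pose A t := (Aa t).1; pose a t := (Aa t).2.
have a_bounded : bounded_seq a by exists k.
pose conj X t := (A t)^T *m X *m A t.
have conj_bounded Z : bounded_seq (conj Z).
  exists (entry_sum Z) => t; apply: orthogonal_conj_norm_le.
  exact: S_orthogonal (AaS t).
(* These are the terms without an explicit factor t; they involve only the bounded [a t] and the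
   bounded conjugates of X and Y. *)
pose d t := form (0, X *m a t) (0, Y *m a t) - form (0, X *m a t) (Y, 0)
  - form (X, 0) (0, Y *m a t) + form (X, 0) (Y, 0)
  - form (conj X t, 0) (conj Y t, 0).
have d_bounded : bounded_seq d.
{ rewrite /d; repeat first [apply: bounded_seqB | apply: bounded_seqD].
  all: first [exact: bounded_seq_cst | apply: bounded_seq_form].
  all: try exact: bounded_seq_cst; try exact: bounded_seq_rot.
  all: by apply: bounded_seq_trans; exact: bounded_seq_mulmx. }
exists a, d; split => // t.
have := S_invariant (AaS t) skX skY; rewrite -/(conj X t) -/(conj Y t) => inv.
rewrite /d -inv.
have expand (Z : 'M[R]_n) : (Z, - (Z *m (t%:R *: x + a t)))
    = (Z, 0) - t%:R *: (0, Z *m x) - (0, Z *m a t) :> 'M[R]_n * 'cV[R]_n.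
  rewrite -[RHS]/(Z - t%:R *: 0 - 0, 0 - t%:R *: (Z *m x) - Z *m a t).
  by rewrite mulmxDr scalemxAr scaler0 !subr0 opprD sub0r.
rewrite !expand !(pullback_formDl, pullback_formNl, pullback_formZl).
rewrite !(pullback_formDr, pullback_formNr, pullback_formZr).
ring.
Qed.

Lemma cocompact_form_translation : (1 < n)%N -> n <> 3%N ->
  forall v w X, skew_sym X -> form (0, v) (X, w) = 0.
Proof.
move=> n_gt1 n_neq3.
(* With X = Y the coefficient of t^2 is <X x, X x>, and the linear coefficient is bounded because
   [a] is. *)
have form_tt : forall v w, form (0, v) (0, w) = 0.
  apply: form_translations => // X x skX.
  have [a [d [ba bd eq0]]] := coarse_identity x skX skX.
  apply: (quadratic_bounded_coef _ bd eq0).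
  apply: bounded_seqB; last exact: bounded_seq_cst.
  apply: bounded_seqB; last exact: bounded_seq_cst.
  by apply: bounded_seqD; apply: bounded_seq_form;
    try exact: bounded_seq_cst; apply: bounded_seq_trans;
    exact: bounded_seq_mulmx.
have form_tr : forall v X, skew_sym X -> form (0, v) (X, 0) = 0.
  apply: form_translation_rotation => // X Y x skX skY.
  have [a [d [_ bd eq0]]] := coarse_identity x skX skY.
  (* Now the products of translations vanish and the identity reads d t = c t with c constant.
     Multiplied by t it becomes c t^2 - (d t) t = 0, so the same lemma gives c = 0. *)
  apply: (quadratic_bounded_coef (bounded_seqN bd) (bounded_seq_cst 0)) => t.
  move: (eq0 t); rewrite !form_tt => eq0t.
  have -> : d t = (form (0, X *m x) (Y, 0) + form (X, 0) (0, Y *m x)) * t%:R.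
    by apply/eqP; rewrite -subr_eq0 -[X in _ == X]eq0t; apply/eqP; ring.
  ring.
move=> v w X skX.
have -> : (X, w) = (X, 0) + (0, w) :> 'M[R]_n * 'cV[R]_n.
  by rewrite -[RHS]/(X + 0, 0 + w) addr0 add0r.
by rewrite pullback_formDr form_tr // form_tt addr0.
Qed.

End CocompactInvariance.

(** * Curves *)

Section LinearContinuity.
Variables (R : realType) (W : normedModType R).

Lemma mx_linear_continuous p q (f : {linear 'M[R]_(p, q) -> W}) : continuous f.
Proof.
have -> : (f : _ -> W)
    = \sum_i \sum_j (fun X : 'M[R]_(p, q) => X i j *: f (delta_mx i j)).
  apply/funext => X; rewrite {1}(matrix_sum_delta X) linear_sum fct_sumE.
  apply: eq_bigr => i _; rewrite linear_sum fct_sumE.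
  by apply: eq_bigr => j _; rewrite linearZ.
move=> X; apply: differentiable_continuous; apply: differentiable_sum => i.
apply: differentiable_sum => j; apply: differentiableZl.
exact: differentiable_coord.
Qed.

Lemma mx_pair_linear_continuous p q r s
    (f : {linear ('M[R]_(p, q) * 'M[R]_(r, s))%type -> W}) : continuous f.
Proof.
pose f1 X := f (X, 0); pose f2 X := f (0, X).
have lf1 : linear f1.
  move=> a X Y; rewrite /f1 -linearP; congr (f _).
  by rewrite -[RHS]/(a *: X + Y, a *: 0 + 0) scaler0 addr0.
have lf2 : linear f2.
  move=> a X Y; rewrite /f2 -linearP; congr (f _).
  by rewrite -[RHS]/(a *: 0 + 0, a *: X + Y) scaler0 addr0.
pose lF1 := GRing.isLinear.Build _ _ _ _ _ lf1.
pose L1 : {linear 'M[R]_(p, q) -> W} := HB.pack f1 lF1.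
pose lF2 := GRing.isLinear.Build _ _ _ _ _ lf2.
pose L2 : {linear 'M[R]_(r, s) -> W} := HB.pack f2 lF2.
have -> : (f : _ -> W) = (L1 \o fst) + (L2 \o snd).
  apply/funext => -[X Y] /=; rewrite -[RHS]/(f (X, 0) + f (0, Y)) -linearD.
  by congr (f _); rewrite -[RHS]/(X + 0, 0 + Y) addr0 add0r.
move=> XY; apply: continuousD; apply: continuous_comp;
  [exact: cvg_fst | exact: mx_linear_continuous | exact: cvg_snd
  | exact: mx_linear_continuous].
Qed.

End LinearContinuity.

Section Curves.
Variables (R : realType) (V W : normedModType R).

Lemma is_derive_diff_comp (c : R -> V) (F : V -> W) (t : R) (Z : V) :
  differentiable F (c t) -> is_derive t 1 c Z ->
  is_derive t 1 (F \o c) ('d F (c t) Z).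
Proof.
move=> dF [/derivable1_diffP dc <-]; apply: DeriveDef.
  by apply/derivable1_diffP; exact: differentiable_comp.
rewrite !deriveE //; last exact: differentiable_comp.
by rewrite diff_comp.
Qed.

Lemma is_derive_linear_comp (c : R -> V) (L : {linear V -> W}) (t : R) (Z : V) :
  continuous L -> is_derive t 1 c Z -> is_derive t 1 (L \o c) (L Z).
Proof.
move=> cL dc; have dL : differentiable L (c t) by exact: linear_differentiable.
by have := is_derive_diff_comp dL dc; rewrite diff_lin.
Qed.

End Curves.

Section ExplicitCurves.
Variables (R : realType) (V : normedModType R).

Lemma is_derive_scalel (f : R -> R) (df t : R) (v : V) :
  is_derive t 1 f df -> is_derive t 1 (fun s => f s *: v) (df *: v).
Proof.
move=> dvf; have dscal : differentiable ( *:%R^~ v : R -> V) (f t).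
  by apply: ex_diff; exact: is_diff_scalel.
have := is_derive_diff_comp dscal dvf.
by rewrite diff_val.
Qed.

Lemma is_derive_line (p v : V) (t : R) : is_derive t 1 (fun s => p + s *: v) v.
Proof.
rewrite -[X in is_derive _ _ _ X]add0r -[X in 0 + X]scale1r.
by apply: is_deriveD; exact: is_derive_scalel.
Qed.

(** The shape of Rodrigues' formula: 1 - cos has derivative 0 at 0, so only the sine term
    contributes to the velocity. *)
Lemma is_derive_rotation_curve (p v w : V) :
  is_derive (0 : R) 1 (fun s => p + sin s *: v + (1 - cos s) *: w) v.
Proof.
have dsin : is_derive (0 : R) 1 (fun s => sin s *: v) v.
  have := is_derive_scalel v (is_derive_sin (0 : R)).
  by rewrite cos0 scale1r.
have dcos : is_derive (0 : R) 1 (fun s => (1 - cos s) *: w) 0.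
  have := is_derive_scalel w (is_deriveB (is_derive_cst (1 : R) (0 : R) (1 : R))
    (is_derive_cos (0 : R))).
  by rewrite sin0 oppr0 subr0 scale0r.
have := is_deriveD (is_deriveD (is_derive_cst p (0 : R) (1 : R)) dsin) dcos.
by rewrite add0r addr0.
Qed.

(** The mean value theorem is applied to each coordinate between 0 and t. *)
Lemma derive0_locally_cst m (y : R -> 'rV[R]_m) (e : R) :
  (forall t : R, `|t| < e -> is_derive t 1 y 0) ->
  forall t : R, `|t| < e -> y t = y 0.
Proof.
move=> dy t te; apply/rowP => i.
have dyi (s : R) : `|s| < e -> is_derive s 1 (fun r => y r 0 i) 0.
  move=> /dy[dys Dys]; apply: DeriveDef.
    by move/derivable_mxP: dys; apply.
  have := derive_mx dys; rewrite Dys => /matrixP/(_ 0 i).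
  by rewrite !mxE.
have cyi (s : R) : `|s| < e -> {for s, continuous (fun r => y r 0 i)}.
  move=> /dyi[/derivable1_diffP dyis _]; exact: differentiable_continuous.
have in_e (a b s : R) : `|a| < e -> `|b| < e -> a <= s <= b -> `|s| < e.
  by rewrite !ltr_norml => /andP[? ?] /andP[? ?] /andP[? ?]; apply/andP; lra.
have cst (a b : R) : `|a| < e -> `|b| < e -> a <= b -> y b 0 i = y a 0 i.
  move=> ae be ab.
  have [||c _] := @MVT_segment R (fun r => y r 0 i) (fun=> 0) a b ab.
  - by move=> s /itvP sab; apply/dyi/(in_e a b) => //; rewrite !sab.
  - apply: continuous_in_subspaceT => s; rewrite inE /= => /itvP sab.
    by apply/cyi/(in_e a b) => //; rewrite !sab.
  by rewrite mul0r => /eqP; rewrite subr_eq0 => /eqP.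
have e0 : `|0 : R| < e by rewrite normr0 (le_lt_trans _ te).
by have [/cst->//|/ltW/cst->] := leP 0 t.
Qed.

End ExplicitCurves.

(** The entries of G^T G = 1 are differentiated at 0, where G = 1. *)
Lemma orthogonal_derive_skew (R : realType) n (G : R -> 'M[R]_n)
    (G' : 'M[R]_n) :
  (forall t, (G t)^T *m G t = 1%:M) -> G 0 = 1%:M ->
  is_derive (0 : R) 1 G G' -> skew_sym G'.
Proof.
move=> orthG G0 [dG DG]; apply/eqP/matrixP => i j; rewrite !mxE.
have dGe k l : is_derive (0 : R) 1 (fun t => G t k l) (G' k l).
  apply: DeriveDef; first by move/derivable_mxP: dG; apply.
  by rewrite -DG derive_mx // mxE.
have : is_derive (0 : R) 1 (\sum_k ((fun t => G t k i) * (fun t => G t k j)))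
  (\sum_k (G 0 k i *: G' k j + G 0 k j *: G' k i)).
  by apply: is_derive_sum => k; exact: is_deriveM.
have -> : \sum_k ((fun t => G t k i) * (fun t => G t k j)) = cst ((i == j)%:R).
  apply/funext => t; rewrite fct_sumE; have /matrixP/(_ i j) := orthG t.
  by rewrite !mxE => <-; apply: eq_bigr => k _; rewrite mxE.
move=> [_]; rewrite derive_cst G0 big_split /=.
rewrite (bigD1 i) //= big1 => [|k /negPf ki]; last by rewrite mxE ki scale0r.
rewrite (bigD1 j) //= big1 => [|k /negPf kj]; last by rewrite mxE kj scale0r.
rewrite !mxE !eqxx !addr0 !scale1r => /esym/eqP.
by rewrite addrC addr_eq0 => /eqP.
Qed.

(** * Adjoint action and curves through the identity of E_n *)

Section EuclideanGroup.
Variables (R : realType) (n : nat).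
Local Notation E := (euclid R n).
Local Notation amb := ('M[R]_n * 'cV[R]_n)%type.

(* The adjoint action on so_n + R^n, extended linearly to all pairs. *)
Definition euclid_ad (h : E) (Z : amb) : amb :=
  ((val h).1 *m Z.1 *m (val h).1^T,
   (val h).1 *m Z.2 - (val h).1 *m Z.1 *m (val h).1^T *m (val h).2).

Lemma euclid_ad_linear h : linear (euclid_ad h).
Proof.
move=> a X Y; rewrite -[RHS]/(_ + _, _ + _) /=; congr (_, _).
  by rewrite mulmxDr mulmxDl -!scalemxAr -scalemxAl.
rewrite mulmxDr -!scalemxAr mulmxDr !mulmxDl -!scalemxAr -!scalemxAl.
by rewrite scalerBr opprD addrACA.
Qed.

HB.instance Definition _ h :=
  GRing.isLinear.Build _ _ _ _ (euclid_ad h) (euclid_ad_linear h).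

Lemma euclid_orth (h : E) : (val h).1^T *m (val h).1 = 1%:M.
Proof. by case: h => [[A v] /= /eqP]. Qed.

(** Conjugation is affine in the ambient pair, so its derivative along any curve is
    [euclid_ad h]. *)
Lemma val_euclid_conj (h g : E) :
  val (h * g * h^-1)%g = euclid_ad h (val g) + (0, (val h).2).
Proof.
rewrite /euclid_ad; case: h => [[A v] pA]; case: g => [[B w] pB] /=.
rewrite -[RHS]/(_ + _, _ + _) /= addr0; congr (_, _).
by rewrite mulmxN mulmxA [v + _]addrC addrAC.
Qed.

(** Right multiplication extends linearly to all pairs, whereas left multiplication is only
    affine. *)
Definition euclid_rmul (h : E) (Z : amb) : amb :=
  (Z.1 *m (val h).1, Z.2 + Z.1 *m (val h).2).

Lemma euclid_rmul_linear h : linear (euclid_rmul h).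
Proof.
move=> a X Y; rewrite -[RHS]/(_ + _, _ + _) /=; congr (_, _).
  by rewrite mulmxDl -scalemxAl.
by rewrite mulmxDl -scalemxAl scalerDr addrACA.
Qed.

HB.instance Definition _ h :=
  GRing.isLinear.Build _ _ _ _ (euclid_rmul h) (euclid_rmul_linear h).

Lemma val_euclid_mulr (g h : E) : val (g * h)%g = euclid_rmul h (val g).
Proof. by rewrite /euclid_rmul; case: g => [[]]; case: h => [[]]. Qed.

Lemma near_euclid_open (T : topologicalType) (c : T -> E) (t : T) (U : set E) :
  {for t, continuous (fun s => val (c s))} -> open U -> U (c t) ->
  \forall s \near t, U (c s).
Proof.
move=> cc [V oV <-] Vct; apply: cc; exact: open_nbhs_nbhs.
Qed.

(* Rodrigues' formula for exp (t X) when X ^ 3 = - X. *)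
Definition rotation (X : 'M[R]_n) (t : R) : 'M[R]_n :=
  1%:M + sin t *: X + (1 - cos t) *: (X *m X).

(** With Y = X^2, s = sin t and c = 1 - cos t, the relations XY = YX = -X and YY = -Y reduce the
    product to 1 + (2c - s^2 - c^2) Y, whose last coefficient is 0. *)
Lemma rotation_orthogonal (X : 'M[R]_n) (t : R) :
  skew_sym X -> X *m X *m X = - X ->
  (rotation X t)^T *m rotation X t == 1%:M.
Proof.
move=> /eqP skX X3; pose Y := X *m X; pose s := sin t; pose c := 1 - cos t.
have XY : X *m Y = - X by rewrite mulmxA.
have YX : Y *m X = - X by [].
have YY : Y *m Y = - Y by rewrite {1}/Y -mulmxA XY mulmxN.
have -> : (rotation X t)^T = 1%:M - s *: X + c *: Y.
  by rewrite !linearD !linearZ /= trmx1 trmx_mul skX mulNmx mulmxN opprK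
    scalerN.
rewrite /rotation -/s -/c -/Y !mulmxDr !mulmxDl !mulmx1 !mul1mx.
rewrite -!scalemxAr !mulNmx -!scalemxAl XY YX YY -/Y.
have sc0 : c + c - s * s - c * c = 0.
  by have := cos2Dsin2 t; rewrite /c /s; nra.
clearbody Y s c; apply/eqP/matrixP => i j; rewrite !mxE.
transitivity ((i == j)%:R + (c + c - s * s - c * c) * Y i j); first by ring.
by rewrite sc0 mul0r addr0.
Qed.

Definition tangent_at_one (Z : amb) := exists2 c : R -> E,
  c 0 = 1%g & is_derive (0 : R) 1 (fun t => val (c t)) Z.

Lemma euclid_translation_subproof (v : 'cV[R]_n) :
  (1%:M : 'M[R]_n, v).1^T *m (1%:M : 'M[R]_n, v).1 == 1%:M.
Proof. by rewrite /= trmx1 mulmx1. Qed.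

Definition euclid_translation v : E := Euclid (euclid_translation_subproof v).

Lemma euclid_translationD v w :
  euclid_translation (v + w) = (euclid_translation v * euclid_translation w)%g.
Proof. by apply: val_inj; rewrite /= !mul1mx. Qed.

Lemma euclid_translation0 : euclid_translation 0 = 1%g.
Proof. exact: val_inj. Qed.

Lemma is_derive_translation v :
  is_derive (0 : R) 1 (fun t : R => val (euclid_translation (t *: v))) (0, v).
Proof.
have := is_derive_line (val (1%g : E)) (0 : 'M[R]_n, v) 0.
have -> // : (fun s : R => val (1%g : E) + s *: (0 : 'M[R]_n, v))
  = (fun t => val (euclid_translation (t *: v))).
apply/funext => t; rewrite -[LHS]/(1%:M + t *: 0, 0 + t *: v).
by rewrite scaler0 addr0 add0r.
Qed.

Lemma tangent_translation v : tangent_at_one (0, v).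
Proof.
exists (fun t : R => euclid_translation (t *: v)).
  by apply: val_inj; rewrite /= scale0r.
exact: is_derive_translation.
Qed.

Lemma tangent_rotation X :
  skew_sym X -> X *m X *m X = - X -> tangent_at_one (X, 0).
Proof.
move=> skX X3.
exists (fun t => @Euclid R n (rotation X t, 0) (rotation_orthogonal t skX X3)).
  apply: val_inj => /=; rewrite /rotation sin0 cos0 subrr !scale0r.
  by rewrite !addr0.
have := is_derive_rotation_curve (val (1%g : E)) (X, 0) (X *m X, 0).
have -> // : (fun s : R => val (1%g : E) + sin s *: (X, 0)
    + (1 - cos s) *: (X *m X, 0)) = (fun t => (rotation X t, 0)).
apply/funext => t.
rewrite -[LHS]/(_ + _ *: _ + _ *: _, 0 + _ *: 0 + _ *: 0) /=.
by rewrite !scaler0 !addr0.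
Qed.

Lemma is_derive_conj (h : E) (c : R -> E) (t : R) Z :
  is_derive t 1 (fun s => val (c s)) Z ->
  is_derive t 1 (fun s => val (h * c s * h^-1)%g) (euclid_ad h Z).
Proof.
move=> dc; under eq_fun do rewrite val_euclid_conj.
rewrite -[X in is_derive _ _ _ X]addr0.
apply: is_deriveD; apply: (@is_derive_linear_comp _ _ _ _ (euclid_ad h)) => //.
exact: mx_pair_linear_continuous.
Qed.

End EuclideanGroup.

(** * The homogeneous space *)

Section HomogeneousSpace.
Variables (R : realType) (n : nat) (H : groupClosed (euclid R n)).
Local Notation E := (euclid R n).
Local Notation proj := (@homogeneous_pi R n H).

Lemma homogeneous_piP (x y : E) : proj x = proj y <-> (x^-1 * y)%g \in H.
Proof.
split=> [/(@eqmodP _ (coset_equiv H))//|xy].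
by apply/(@eqmodP _ (coset_equiv H)).
Qed.

Lemma homogeneous_pi_mulr (g h : E) : h \in H -> proj (g * h)%g = proj g.
Proof. by move=> hH; apply/esym/homogeneous_piP; rewrite mulKg. Qed.

Lemma homogeneous_act_pi (g x : E) :
  homogeneous_act g (proj x) = proj (g * x)%g.
Proof. exact: coset_act_pi. Qed.

Lemma homogeneous_pi_surj (p : homogeneous_space H) : exists g, proj g = p.
Proof. by exists (repr p); exact: reprK. Qed.

Lemma euclid_mulr_continuous (h : E) : continuous (fun g : E => (g * h)%g).
Proof.
apply: continuous_comp_initial => g.
rewrite (_ : _ \o _ = euclid_rmul h \o val); last first.
  by apply/funext => g' /=; rewrite -val_euclid_mulr.
apply: continuous_comp; first exact: initial_continuous.
exact: mx_pair_linear_continuous.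
Qed.

(** The saturation of U is a union of preimages of U under right multiplications by elements of H,
    which are continuous. *)
Lemma homogeneous_pi_open (U : set E) : open U -> open (proj @` U).
Proof.
move=> oU; rewrite /open /= /quotient_open.
rewrite (_ : _ @^-1` _ = \bigcup_(h in [set h | h \in H])
                           ((fun g => (g * h)%g) @^-1` U)).
  apply: bigcup_open => h _; move/continuousP: (@euclid_mulr_continuous h).
  exact.
apply/seteqP; split=> g /=.
  move=> [u Uu /homogeneous_piP ug]; exists (g^-1 * u)%g => /=.
    by rewrite -gpredV invgM invgK.
  by rewrite mulVKg.
by move=> [h /= hH Ugh]; exists (g * h)%g => //; exact: homogeneous_pi_mulr.
Qed.

(** By compactness every coset has a representative with translation part shorter than some fixed k.
    If u represents the coset of the translation by -x, then the translation by x times u lies in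
    H. *)
Lemma compact_coarse : compact [set: homogeneous_space H] ->
  exists k : R, forall x : 'cV[R]_n, exists2 Aa : 'M[R]_n * 'cV[R]_n,
    `|Aa.2| <= k & exists2 h, h \in H & val h = (Aa.1, x + Aa.2).
Proof.
pose U (k : nat) := [set g : E | `|(val g).2| < k%:R].
have oU k : open (U k).
  exists [set Z | `|Z.2| < k%:R] => //.
  apply: (@open_comp _ _ (fun Z : 'M[R]_n * 'cV[R]_n => `|Z.2|)
    [set r | r < k%:R]).
    move=> Z _; apply: continuous_comp; first exact: cvg_snd.
    exact: norm_continuous.
  exact: open_lt.
(* The images of the sets [U k] are open, increase with k and cover the quotient, so a single k
   serves all points. *)
move=> /compact_near_coveringP.
move=> /(_ nat \oo (fun k p => (proj @` U k) p) _)[] => [p _|k _ kU].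
  have [g gp] := homogeneous_pi_surj p.
  pose k := (Num.truncn `|(val g).2|).+1.
  have kU : nbhs p (proj @` U k).
    apply: open_nbhs_nbhs; split; first exact/homogeneous_pi_open/oU.
    by exists g => //=; rewrite /U /= truncnS_gt.
  exists (proj @` U k, [set j | (k <= j)%N]) => /=.
    by split; last exact: nbhs_infty_ge.
  move=> [q j] /= [[u Uu <-] kj]; exists u => //.
  by apply: lt_le_trans Uu _; rewrite ler_nat.
exists k%:R => x.
have [u /= Uu /homogeneous_piP hH] :=
  kU k (leqnn k) (proj (euclid_translation (- x))) I.
exists ((val u).1, (val u).2); first exact: ltW.
exists ((euclid_translation x * u)%g).
  rewrite -gpredV (_ : (_ * _)^-1 = u^-1 * euclid_translation (- x))%g //.
  rewrite invgM; congr (_ * _)%g; apply: (mulgI (euclid_translation x)).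
  rewrite mulgV; apply: val_inj => /=; rewrite !mul1mx.
  by rewrite addrN.
by case: u {Uu hH} => [[A a] pu] /=; rewrite !mul1mx.
Qed.

End HomogeneousSpace.

(** * Invariant metrics *)

Lemma smooth_differentiable (R : realType) (V W : normedModType R) (U : set V)
  (f : V -> W) x : smooth U f -> U x -> differentiable f x.
Proof. by move=> /(_ 1%N)[+ _]; apply. Qed.

Section InvariantMetric.
Variables (R : realType) (n m : nat) (H : groupClosed (euclid R n)).
Local Notation E := (euclid R n).
Local Notation proj := (@homogeneous_pi R n H).
Variables (A : set (chart R (homogeneous_space H) m)).
Variables (B : tensor2 R (homogeneous_space H) m).
Hypothesis atlasA : homogeneous_atlas A.
Hypothesis metricB : pseudo_riemannian A B.
Hypothesis invB : forall g, preserves A B (homogeneous_act g).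

Variables (c : chart R (homogeneous_space H) m).
Hypothesis Ac : A c.
Local Notation p0 := (proj 1%g).
Hypothesis c_p0 : chart_dom c p0.
Local Notation x0 := (chart_map c p0).

(** F extends the orbit map, read in the chart c, to the ambient space near 1. Its differential has
    an intrinsic meaning only on vectors tangent to E_n, whence the conditions that linear parts be
    skew. *)
Variables (F : 'M[R]_n * 'cV[R]_n -> 'rV[R]_m) (N : set ('M[R]_n * 'cV[R]_n)).
Hypothesis N1 : open_nbhs (val (1%g : E)) N.
Hypothesis dF : differentiable F (val (1%g : E)).
Hypothesis FE : forall h, chart_dom c (proj h) -> N (val h) ->
  F (val h) = chart_map c (proj h).

Local Notation D := ('d F (val (1%g : E))).
Local Notation form := (pullback_form D (B c x0)).

Let open_dom : open (proj @^-1` chart_dom c).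
Proof. by have [[/(_ c Ac)[]]] := atlasA. Qed.

Lemma near_chart_dom (T : topologicalType) (g : T -> E) t :
  {for t, continuous (fun s => val (g s))} -> g t = 1%g ->
  \forall s \near t, chart_dom c (proj (g s)) /\ N (val (g s)).
Proof.
move=> cg gt; have [oN NN1] := N1.
apply: (@near_euclid_open _ _ _ g t
  (proj @^-1` chart_dom c `&` (val @^-1` N))) => //; last by rewrite gt.
by apply: openI => //; exists N.
Qed.

Lemma chart_curve (g : R -> E) Z :
  g 0 = 1%g -> is_derive (0 : R) 1 (fun t => val (g t)) Z ->
  is_derive (0 : R) 1 (fun t => chart_map c (proj (g t))) (D Z).
Proof.
move=> g0 dg; have dvg : differentiable (fun t => val (g t)) 0.
  by apply/derivable1_diffP; case: dg.
apply: (@near_eq_is_derive _ _ _ (F \o (fun t => val (g t)))).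
  have := near_chart_dom (differentiable_continuous dvg) g0.
  by apply: filterS => t [domt Nt] /=; rewrite FE.
have dFg : differentiable F (val (g 0)) by rewrite g0.
by have := is_derive_diff_comp dFg dg; rewrite /= g0.
Qed.

Lemma chart_invK p : chart_dom c p -> chart_inv c (chart_map c p) = p.
Proof. by have [[/(_ c Ac)[_ _ invK _ _] _ _] _ _] := atlasA; exact: invK. Qed.

(** For h in H the cosets of h g(t) and h g(t) h^-1 agree; both sides are the velocities at 0 of
    this one curve in the quotient. *)
Lemma diff_act_tangent (h : E) Z : h \in H -> tangent_at_one Z ->
  'd (in_charts (homogeneous_act h) c c) x0 (D Z) = D (euclid_ad h Z).
Proof.
move=> hH [g g0 dg].
have proj_h : proj h = p0 by apply/homogeneous_piP; rewrite mulg1 gpredV.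
have [|df _] := @invB h c c p0 Ac Ac c_p0.
  by rewrite homogeneous_act_pi mulg1 proj_h.
pose k t := (h * g t * h^-1)%g.
have k0 : k 0 = 1%g by rewrite /k g0 mulg1 mulgV.
have dk : is_derive (0 : R) 1 (fun t => val (k t)) (euclid_ad h Z).
  exact: is_derive_conj.
pose y t := chart_map c (proj (g t)).
have dfy : differentiable (in_charts (homogeneous_act h) c c) (y 0).
  by rewrite /y g0.
have dfy' := is_derive_diff_comp dfy (chart_curve g0 dg).
have <- : 'd (in_charts (homogeneous_act h) c c) (y 0) (D Z)
  = 'd (in_charts (homogeneous_act h) c c) x0 (D Z) by rewrite /y g0.
rewrite -(@derive_val _ _ _ _ _ _ _ dfy').
rewrite -(@derive_val _ _ _ _ _ _ _ (chart_curve k0 dk)).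
apply: near_eq_derive.
have dvg : differentiable (fun t => val (g t)) 0.
  by apply/derivable1_diffP; case: dg.
have := near_chart_dom (differentiable_continuous dvg) g0.
apply: filterS => t [domt _] /=; rewrite /in_charts /= chart_invK //.
by rewrite homogeneous_act_pi /k [in RHS]homogeneous_pi_mulr // gpredV.
Qed.

(** Both sides are linear in Z, so it suffices to treat translations and the generators
    [rotgen i j], for which explicit curves are available. *)
Lemma diff_act (h : E) Z : h \in H -> skew_sym Z.1 ->
  'd (in_charts (homogeneous_act h) c c) x0 (D Z) = D (euclid_ad h Z).
Proof.
move=> hH; case: Z => X v /= skX; pose L Z :=
  'd (in_charts (homogeneous_act h) c c) x0 (D Z) = D (euclid_ad h Z).
have LD Z Z' : L Z -> L Z' -> L (Z + Z').
  by rewrite /L => LZ LZ'; rewrite !linearD LZ LZ'.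
have LZ a Z : L Z -> L (a *: Z) by rewrite /L => LZ; rewrite !linearZ LZ.
have -> : (X, v) = (X, 0) + (0, v) :> 'M[R]_n * 'cV[R]_n.
  by rewrite -[RHS]/(X + 0, 0 + v) addr0 add0r.
apply: (LD); last by apply: diff_act_tangent => //; exact: tangent_translation.
elim/skew_ind: skX => [|Y Y'|a Y|i j].
- by rewrite /L !linear0.
- by move=> /LD{}LD /LD; rewrite -[(Y, 0) + _]/(Y + Y', 0 + 0) addr0.
- by move=> /(LZ a); rewrite -[_ *: _]/(a *: Y, a *: 0) scaler0.
apply: diff_act_tangent => //; apply: tangent_rotation.
  exact: skew_rotgen.
exact: rotgen_cube.
Qed.

(** Since h fixes the base point, its differential there preserves [B c x0], and [diff_act]
    identifies it with the adjoint action. *)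
Lemma form_ad_invariant (h : E) Z Z' :
  h \in H -> skew_sym Z.1 -> skew_sym Z'.1 ->
  form (euclid_ad h Z) (euclid_ad h Z') = form Z Z'.
Proof.
move=> hH skZ skZ'; rewrite /pullback_form -!diff_act //.
have proj_h : proj h = p0 by apply/homogeneous_piP; rewrite mulg1 gpredV.
have [|_] := @invB h c c p0 Ac Ac c_p0.
  by rewrite homogeneous_act_pi mulg1 proj_h.
have -> : in_charts (homogeneous_act h) c c x0 = x0.
  by rewrite /in_charts /= chart_invK // homogeneous_act_pi mulg1 proj_h.
move=> eqB; rewrite [in RHS]eqB.
have act_jac Y : 'd (in_charts (homogeneous_act h) c c) x0 Y
    = Y *m jacobian (in_charts (homogeneous_act h) c c) x0.
  by rewrite /jacobian mul_rV_lin1.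
by rewrite !act_jac trmx_mul !mulmxA.
Qed.

Lemma metric_unit : B c x0 \in unitmx.
Proof.
have [_ _ _ [q _ /(_ c p0 Ac c_p0)[P _ eqP]]] := metricB.
have : P *m B c x0 *m P^T \in unitmx.
  rewrite eqP unitmxE det_diag; apply: rpred_prod => i _.
  by rewrite mxE unitrX // unitrN unitr1.
by rewrite !unitmx_mul => /andP[/andP[]].
Qed.

(** A smooth local section lifts the line through x0 in direction u to a curve in E_n; Z is the
    velocity of this lift, moved to start at 1. *)
Lemma diff_chart_surj u : exists2 Z, skew_sym Z.1 & D Z = u.
Proof.
have [[/(_ c Ac)[oc oV invK _ cinv] _ _] _ /(_ p0)[U [oU Up0]]] := atlasA.
move=> [s sK s_smooth].
pose line (t : R) := x0 + t *: u.
have line0 : line 0 = x0 by rewrite /line scale0r addr0.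
have dline : is_derive (0 : R) 1 line u by exact: is_derive_line.
have Vx0 : (chart_map c @` chart_dom c) x0 by exists p0.
have near_line : \forall t \near (0 : R),
    (chart_map c @` chart_dom c) (line t) /\ U (chart_inv c (line t)).
  have cline : {for (0 : R), continuous line}.
    apply: differentiable_continuous; apply/derivable1_diffP.
    by case: dline.
  have nV : nbhs x0 (chart_map c @` chart_dom c) by exact: open_nbhs_nbhs.
  have nU : nbhs x0 [set x | U (chart_inv c x)].
    by apply: (cinv _ Vx0); rewrite invK //; exact: open_nbhs_nbhs.
  rewrite -line0 in nV nU.
  exact: (filterI (cline _ nV) (cline _ nU)).
have s0H : s p0 \in H.
  by have /homogeneous_piP := esym (sK p0 Up0); rewrite invg1 mul1g.
(* As [s p0] lies in H, the right factor makes the curve start at 1 without changing its cosets. *)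
pose g t := (s (chart_inv c (line t)) * (s p0)^-1)%g.
have g0 : g 0 = 1%g by rewrite /g line0 invK // mulgV.
pose sigma x := val (s (chart_inv c x)).
have ds : differentiable sigma (line 0).
  rewrite line0; apply: smooth_differentiable (s_smooth c Ac) _.
  by exists p0.
pose Z := euclid_rmul (s p0)^-1%g ('d sigma (line 0) u).
have dg : is_derive (0 : R) 1 (fun t => val (g t)) Z.
  have -> : (fun t => val (g t)) = euclid_rmul (s p0)^-1%g \o (sigma \o line).
    by apply/funext => t /=; rewrite -val_euclid_mulr.
  have dsl := is_derive_diff_comp ds dline.
  have crmul : continuous (euclid_rmul (s p0)^-1%g).
    exact: mx_pair_linear_continuous.
  have := is_derive_linear_comp crmul dsl.
  exact.
exists Z.
  apply: (@orthogonal_derive_skew _ _ (fun t => (val (g t)).1)).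
  - by move=> t; exact: euclid_orth.
  - by rewrite g0.
  apply: (@is_derive_linear_comp _ _ _ (fun t => val (g t)) fst) => // z.
  exact: cvg_fst.
have dchart := chart_curve g0 dg.
rewrite -(@derive_val _ _ _ _ _ _ _ dchart).
rewrite -[RHS](@derive_val _ _ _ _ _ _ _ dline).
apply: near_eq_derive; apply: filterS near_line => t [[p cp pt]].
rewrite -pt invK // => Up.
by rewrite /g homogeneous_pi_mulr ?gpredV // -pt invK // sK.
Qed.

(** By surjectivity of D, the vector D Z0 is orthogonal to the whole tangent space, on which the
    metric is nondegenerate. *)
Lemma form_radical Z0 :
  (forall Z, skew_sym Z.1 -> form Z0 Z = 0) -> D Z0 = 0.
Proof.
move=> rad; suff DB0 : D Z0 *m B c x0 = 0.
  by rewrite -[D Z0](mulmxK metric_unit) DB0 mul0mx.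
apply/rowP => j; have [Z skZ DZ] := diff_chart_surj (delta_mx 0 j).
have := rad Z skZ; rewrite /pullback_form DZ trmx_delta -colE.
by rewrite mxE => ->; rewrite mxE.
Qed.

(** The orbit of the base point under the translations by t v has velocity 0 at t = 0, hence at all
    small t, so it is locally constant. Small translations thus lie in H, and so do their powers. *)
Lemma translation_stabilizes :
  (forall v, D (0, v) = 0) -> forall v, euclid_translation v \in H.
Proof.
move=> D0 v; pose tr (t : R) := euclid_translation (t *: v).
have tr0 : tr 0 = 1%g by rewrite /tr scale0r euclid_translation0.
have dtr : is_derive (0 : R) 1 (fun t => val (tr t)) (0, v).
  exact: is_derive_translation.
have near_dom : \forall t \near (0 : R), chart_dom c (proj (tr t)).
  have dvtr : differentiable (fun t => val (tr t)) 0.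
    by apply/derivable1_diffP; case: dtr.
  have := near_chart_dom (differentiable_continuous dvtr) tr0.
  by apply: filterS => t [].
pose y t := chart_map c (proj (tr t)).
have dy0 : is_derive (0 : R) 1 y 0 by rewrite -(D0 v); exact: chart_curve.
have [e /= e0 dom_e] : exists2 e : R, 0 < e &
    forall t, `|t| < e -> chart_dom c (proj (tr t)).
  have /nbhs_ballP[e e0 dom_e] := near_dom.
  by exists e => // t te; apply: dom_e; rewrite /ball /= sub0r normrN.
(* For s near t, y s is the image of y (s - t) under the action of [tr t] in the chart, so the chain
   rule carries the zero velocity from 0 to t. *)
have dy (t : R) : `|t| < e -> is_derive t 1 y 0.
  move=> te; pose f := in_charts (homogeneous_act (tr t)) c c.
  have [|df _] := @invB (tr t) c c p0 Ac Ac c_p0.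
    by rewrite homogeneous_act_pi mulg1; exact: dom_e.
  have df0 : differentiable f (y 0) by rewrite /y tr0.
  have dfy : is_derive (0 : R) 1 (f \o y) 0.
    by have := is_derive_diff_comp df0 dy0; rewrite linear0.
  have dshift : is_derive t 1 (fun s : R => s - t) 1.
    rewrite -[X in is_derive _ _ _ X]subr0; exact: is_deriveB.
  have dfy0 : differentiable (f \o y) (t - t).
    by rewrite subrr; apply/derivable1_diffP; case: dfy.
  have dcomp := is_derive_diff_comp (c := fun s : R => s - t) dfy0 dshift.
  have dcomp0 : 'd (f \o y) (t - t) 1 = 0.
    by rewrite -deriveE // subrr; case: dfy.
  rewrite dcomp0 in dcomp; apply: near_eq_is_derive dcomp.
  have cshift : {for t, continuous (fun s : R => s - t)}.
    apply: differentiable_continuous; apply/derivable1_diffP.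
    by case: dshift.
  have near_dom_t := near_dom; rewrite -(subrr t) in near_dom_t.
  have near_t : \forall s \near t, chart_dom c (proj (tr (s - t))).
    exact: cshift near_dom_t.
  apply: filterS near_t => s /= doms.
  rewrite /f /in_charts /= chart_invK // homogeneous_act_pi.
  by rewrite /tr -euclid_translationD -scalerDl subrKC.
(* This gives 1/(k+1) < e; the (k+1)-st power of the translation by v/(k+1) is the translation by
   v. *)
pose k := Num.truncn e^-1.
have ke : `|k.+1%:R^-1 : R| < e.
  rewrite ger0_norm ?invr_ge0 // invf_plt ?posrE //.
  by rewrite /k truncnS_gt.
have trH : tr k.+1%:R^-1 \in H.
  have := derive0_locally_cst dy ke; rewrite /y tr0.
  move=> /(congr1 (chart_inv c)); rewrite !chart_invK //; last exact: dom_e.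
  by move=> /esym/homogeneous_piP; rewrite invg1 mul1g.
have -> : euclid_translation v = (tr (k.+1%:R^-1)%R ^+ k.+1)%g.
  have trX j : (tr (k.+1%:R^-1)%R ^+ j)%g = tr (j%:R * k.+1%:R^-1).
    elim: j => [|j IHj]; first by rewrite mul0r tr0.
    by rewrite expgS IHj /tr -euclid_translationD -scalerDl -(natr1 j)
      mulrDl mul1r addrC.
  by rewrite trX divff ?pnatr_eq0 // /tr scale1r.
exact: gpredXn.
Qed.

End InvariantMetric.

(** * Trivial action of the translations, against almost effectiveness *)

Theorem theoremJ (R : realType) (n : nat) (n_gt0 : (0 < n)%N)
    (n_neq1 : n <> 1%N) (n_neq3 : n <> 3%N) :
  ~ exists H : groupClosed (euclid R n),
      [/\ closed [set g : euclid R n | g \in H],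
          compact [set: homogeneous_space H],
          almost_effective H &
          invariant_metric H].
Proof.
move=> [H [_ cpt eff [m [A [B [atlasA metricB invB]]]]]].
have n_gt1 : (1 < n)%N.
  by move: n_gt0; rewrite leq_eqVlt => /orP[/eqP/esym|].
have [[_ cov _] smF _] := atlasA.
have [c Ac c_p0] := cov (homogeneous_pi H 1%g).
have [N N1 [F sF FE]] := smF c Ac 1%g c_p0.
have dF : differentiable F (val (1%g : euclid R n)).
  by apply: smooth_differentiable sF _; case: N1.
pose S (M : 'M[R]_n) v := exists2 h, h \in H & val h = (M, v).
have D0 v : 'd F (val (1%g : euclid R n)) (0, v) = 0.
  apply: (form_radical atlasA metricB Ac c_p0 N1 dF FE) => -[X w] /= skX.
  apply: (@cocompact_form_translation _ _ _ _ _ _ _ S) => //.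
  - by move=> Z; exact: diff_continuous.
  - move=> Z Z'; apply: pullback_formC.
    by have [_ _ + _] := metricB; apply.
  - by move=> M u [h _ hE]; have := euclid_orth h; rewrite hE.
  - exact: compact_coarse.
  move=> M u Y Y' [h hH hE] skY skY'.
  have orthM : M *m M^T = 1%:M.
    by have := mulmx1C (euclid_orth h); rewrite hE.
  (* This turns the invariance required for S into invariance under [euclid_ad h] with h in H. *)
  have adE (Q : 'M[R]_n) :
      (Q, - (Q *m u)) = euclid_ad h (M^T *m Q *m M, 0).
    rewrite /euclid_ad hE /= mulmx0 sub0r.
    have -> : M *m (M^T *m Q *m M) *m M^T = Q; last by [].
    by rewrite !mulmxA orthM mul1mx -mulmxA orthM mulmx1.
  have sk_conj (Q : 'M[R]_n) : skew_sym Q -> skew_sym (M^T *m Q *m M).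
    move=> /eqP skQ; apply/eqP.
    by rewrite !trmx_mul trmxK skQ mulNmx mulmxN mulmxA.
  rewrite !adE; apply: (form_ad_invariant atlasA invB Ac c_p0 N1 dF FE) => //=.
    exact: sk_conj.
  exact: sk_conj.
have trH := translation_stabilizes atlasA invB Ac c_p0 N1 dF FE D0.
have kernel_tr v : action_kernel H (euclid_translation v).
  move=> p; have [g <-] := homogeneous_pi_surj p.
  rewrite homogeneous_act_pi.
  (* Translations form a normal subgroup: moved past g, the translation by v becomes that by A^T v
     with A the linear part of g, and H absorbs it. *)
  rewrite (_ : _ * _ = g * euclid_translation ((val g).1^T *m v))%g.
    exact: homogeneous_pi_mulr.
  case: g => [[M u] pM]; apply: val_inj => /=; congr (_, _).
    by rewrite mul1mx mulmx1.
  by rewrite mul1mx mulmxA (mulmx1C (eqP pM)) mul1mx addrC.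
(* Some neighbourhood V of the identity meets the kernel in the identity alone, yet it contains
   nontrivial small translations. *)
have : isolated (action_kernel H) (euclid_translation 0).
  by rewrite eff; exact: kernel_tr.
rewrite euclid_translation0 => -[_ [V nV VE]].
pose v : 'cV[R]_n := const_mx 1.
pose tr (t : R) := euclid_translation (t *: v).
have : \forall t \near (0 : R), V (tr t).
  move: nV; rewrite nbhsE => -[V' [oV' V'1] V'V].
  have ctr : {for (0 : R), continuous (fun t => val (tr t))}.
    apply: differentiable_continuous; apply/derivable1_diffP.
    by case: (is_derive_translation v).
  have := near_euclid_open ctr oV'; rewrite /tr scale0r euclid_translation0.
  by move=> /(_ V'1); apply: filterS => t /V'V.
move=> /nbhs_ballP[e /= e0 Ve].
have Vt : (V `&` action_kernel H) (tr (e / 2)).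
  split; last exact: kernel_tr.
  apply: Ve; rewrite /ball /= sub0r normrN gtr0_norm ?divr_gt0 //.
  by rewrite ltr_pdivrMr // ltr_pMr // ltr1n.
(* At the index 1 the translation has entry e / 2 and the identity has entry 0. *)
pose coord (g : euclid R n) := (val g).2 (Ordinal n_gt0) 0.
move: Vt; rewrite VE /= => /(congr1 coord).
rewrite /coord /= !mxE mulr1 => /eqP.
by rewrite gt_eqF // divr_gt0.
Qed.
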